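(* Let $\nu$ be a partition of $n$ with $m$ parts, and let $A\in M_n(K)$. Then $$\{(BAB^{-1})_{P,Q}\mid B\in\mathcal B_\nu\}$$ is exactly the set of all matrices in $M_m(K)$ that are $\hat\nu$-similar to $A_{P,Q}$.
   Context: $K$ is an algebraically closed field of characteristic zero. A partition $\nu=(\nu_1,\ldots,\nu_m)$ of $n$ is a nonincreasing sequence of positive integers with sum $n$. $J_\nu=J_{\nu_1,0}\dot+\cdots\dot+J_{\nu_m,0}$ is the block diagonal matrix whose diagonal blocks are the upper triangular nilpotent Jordan blocks $J_{\nu_i,0}$ of order $\nu_i$ (ones on the superdiagonal, zeros elsewhere). $\mathcal B_\nu=\{B\in GL_n(K)\mid BJ_\nu=J_\nu B\}$. $P$ (resp. $Q$) is the set of indices of the non-zero rows (resp. non-zero columns) of $J_\nu$; both have $n-m$ elements. For $X\in M_n(K)$, $X_{P,Q}\in M_m(K)$ is the matrix obtained from $X$ by deleting all rows with index in $P$ and all columns with index in $Q$. Write $\nu=(\alpha_1,\ldots,\alpha_1,\alpha_2,\ldots,\alpha_2,\ldots,\alpha_l,\ldots,\alpha_l)$ with $\alpha_1>\alpha_2>\cdots>\alpha_l$, where $\alpha_i$ occurs $s_i\ge1$ times; then $\hat\nu=(s_1,\ldots,s_l)$, so $s_1+\cdots+s_l=m$. For a sequence $\mu=(\mu_1,\ldots,\mu_l)$ of positive integers with sum $m$, matrices in $M_m(K)$ are partitioned into blocks according to $\mu$ (the $(i,j)$ block is $\mu_i\times\mu_j$). Matrices $C,\tilde C\in GL_m(K)$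 are $\mu$-mutual if $C$ is lower block triangular, $\tilde C$ is upper block triangular, and $C_{ii}=\tilde C_{ii}$ for all $i$ (equal respective diagonal blocks). Matrices $X,Y\in M_m(K)$ are $\mu$-similar if there exist $\mu$-mutual $C,\tilde C$ with $CX=Y\tilde C$. *)

(* Defs.v *)
From HB Require Import structures.
From mathcomp Require Import all_boot all_order all_algebra.

Set Implicit Arguments.
Unset Strict Implicit.
Unset Printing Implicit Defensive.

Import GRing.Theory.
Local Open Scope ring_scope.

Record composition (n m : nat) := Composition {
  cparts :> m.-tuple nat;
  cparts_gt0 : all (ltn 0) cparts;
  cparts_sum : (\sum_(i < m) tnth cparts i = n)%N }.

Record intpartition (n m : nat) := IntPartition {
  ipcomp :> composition n m;
  ip_sorted : sorted geq ipcomp }.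

(* The nilpotent Jordan block J_{k,0}, with ones on the superdiagonal. *)
Definition jordan0 (K : fieldType) (k : nat) : 'M[K]_k :=
  \matrix_(i, j) (i.+1 == j :> nat)%:R.

Definition jordan_mx (K : fieldType) (n m : nat) (nu : intpartition n m) :
    'M[K]_n :=
  castmx (cparts_sum nu, cparts_sum nu)
    (\mxdiag_(i < m) jordan0 K (tnth nu i)).

Definition in_centralizer (K : fieldType) (n m : nat) (nu : intpartition n m)
    (B : 'M[K]_n) : Prop :=
  B \in unitmx /\ B *m jordan_mx K nu = jordan_mx K nu *m B.

Definition nzrows (K : fieldType) (n1 n2 : nat) (M : 'M[K]_(n1, n2)) :
    {set 'I_n1} := [set i | row i M != 0].

Definition nzcols (K : fieldType) (n1 n2 : nat) (M : 'M[K]_(n1, n2)) :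
    {set 'I_n2} := [set j | col j M != 0].

(* enum_val lists the elements of a set of ordinals in increasing order, so
   the surviving rows and columns keep their relative order. *)
Definition delmx (K : fieldType) (n1 n2 : nat) (P : {set 'I_n1})
    (Q : {set 'I_n2}) (X : 'M[K]_(n1, n2)) : 'M[K]_(#|~: P|, #|~: Q|) :=
  mxsub (fun i : 'I_(#|~: P|) => enum_val i)
        (fun j : 'I_(#|~: Q|) => enum_val j) X.

Section Cardinals.
Variables (K : fieldType) (n m : nat) (nu : intpartition n m).

Lemma jordan_mxE (i j : 'I_m) (a : 'I_(tnth nu i)) (b : 'I_(tnth nu j)) :
  jordan_mx K nu (cast_ord (cparts_sum nu) (tagnat.Rank i a))
    (cast_ord (cparts_sum nu) (tagnat.Rank j b))
  = ((i == j) && (a.+1 == b :> nat))%:R.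
Proof.
rewrite /jordan_mx castmxE !cast_ordK.
pose M := \mxdiag_(i < m) jordan0 K (tnth nu i).
rewrite -[LHS]/(M _ _).
have -> : M (tagnat.Rank i a) (tagnat.Rank j b) = submxblock M i j a b
  by rewrite [RHS]mxE.
rewrite /M mxblockK; case: eqVneq => [ij|_]; last by rewrite mxE.
by case: _ / ij b => b; rewrite conform_mx_id mxE.
Qed.

Lemma cast_RankP (k : 'I_n) :
  exists i : 'I_m, exists a : 'I_(tnth nu i),
    k = cast_ord (cparts_sum nu) (tagnat.Rank i a).
Proof.
exists (tagnat.sig1 (cast_ord (esym (cparts_sum nu)) k)).
exists (tagnat.sig2 (cast_ord (esym (cparts_sum nu)) k)).
by rewrite tagnat.sig2K cast_ordKV.
Qed.

Lemma cpart_gt0 (i : 'I_m) : (0 < tnth nu i)%N.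
Proof. exact: (all_tnthP (cparts_gt0 nu)). Qed.

Lemma cpart_last (i : 'I_m) : ((tnth nu i).-1 < tnth nu i)%N.
Proof. by rewrite prednK ?cpart_gt0. Qed.

Definition first_idx (i : 'I_m) : 'I_n :=
  cast_ord (cparts_sum nu) (tagnat.Rank i (Ordinal (cpart_gt0 i))).

Definition last_idx (i : 'I_m) : 'I_n :=
  cast_ord (cparts_sum nu) (tagnat.Rank i (Ordinal (cpart_last i))).

Lemma first_idx_inj : injective first_idx.
Proof.
move=> i j /cast_ord_inj /(congr1 val) /eqP /=.
by rewrite tagnat.eq_Rank => /andP[/eqP].
Qed.

Lemma last_idx_inj : injective last_idx.
Proof.
move=> i j /cast_ord_inj /(congr1 val) /eqP /=.
by rewrite tagnat.eq_Rank => /andP[/eqP].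
Qed.

Lemma nzrowsC : ~: nzrows (jordan_mx K nu) = [set last_idx i | i in 'I_m].
Proof.
apply/setP => k; rewrite !inE negbK; apply/eqP/imsetP => [|[i _ ->]].
  have [i [a ->]] := cast_RankP k => /rowP r0; exists i => //.
  rewrite /last_idx; congr (cast_ord _ (tagnat.Rank i _)); apply: val_inj => /=.
  apply/eqP; rewrite -eqSS prednK ?cpart_gt0 // eqn_leq ltn_ord leqNgt /=.
  apply/negP => lta.
  have := r0 (cast_ord (cparts_sum nu) (tagnat.Rank i (Ordinal lta))).
  by rewrite mxE jordan_mxE mxE !eqxx /= => /eqP; rewrite oner_eq0.
apply/rowP => k'; have [j [b ->]] := cast_RankP k'.
rewrite !mxE jordan_mxE /= prednK ?cpart_gt0 //.
case: eqVneq => //= ij; case: _ / ij b => b.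
by rewrite gtn_eqF.
Qed.

Lemma nzcolsC : ~: nzcols (jordan_mx K nu) = [set first_idx i | i in 'I_m].
Proof.
apply/setP => k; rewrite !inE negbK; apply/eqP/imsetP => [|[i _ ->]].
  have [i [[[|a] lta] ->]] := cast_RankP k => /colP r0; exists i => //.
    by rewrite /first_idx; congr (cast_ord _ (tagnat.Rank i _)); apply: val_inj.
  have := r0 (cast_ord (cparts_sum nu) (tagnat.Rank i (Ordinal (ltnW lta)))).
  by rewrite mxE jordan_mxE mxE !eqxx /= => /eqP; rewrite oner_eq0.
apply/colP => k'; have [j [b ->]] := cast_RankP k'.
by rewrite !mxE jordan_mxE /= andbF.
Qed.

Lemma card_nzrowsC : #|~: nzrows (jordan_mx K nu)| = m.
Proof. by rewrite nzrowsC card_imset ?card_ord //; exact: last_idx_inj. Qed.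

Lemma card_nzcolsC : #|~: nzcols (jordan_mx K nu)| = m.
Proof. by rewrite nzcolsC card_imset ?card_ord //; exact: first_idx_inj. Qed.

End Cardinals.

Definition submxPQ (K : fieldType) (n m : nat) (nu : intpartition n m)
    (X : 'M[K]_n) : 'M[K]_m :=
  castmx (card_nzrowsC K nu, card_nzcolsC K nu)
    (delmx (nzrows (jordan_mx K nu)) (nzcols (jordan_mx K nu)) X).

(* As nu is nonincreasing, undup nu lists its distinct parts
   alpha_1 > ... > alpha_l in this order. *)
Definition mult_tuple (n m : nat) (nu : intpartition n m) :
    (size (undup nu)).-tuple nat :=
  map_tuple (fun a => count_mem a nu) (in_tuple (undup nu)).

Lemma mult_tuple_gt0 (n m : nat) (nu : intpartition n m) :
  all (ltn 0) (mult_tuple nu).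
Proof.
apply/allP => _ /mapP[a anu ->] /=.
by rewrite -has_count has_pred1 -mem_undup.
Qed.

Lemma mult_tuple_sum (n m : nat) (nu : intpartition n m) :
  (\sum_(i < size (undup nu)) tnth (mult_tuple nu) i = m)%N.
Proof.
rewrite -(big_tuple _ _ (mult_tuple nu) xpredT id) big_map.
rewrite -[RHS](size_tuple nu) -(perm_size (perm_count_undup nu)) size_flatten.
by rewrite sumnE !big_map; apply: eq_bigr => a _; rewrite size_nseq.
Qed.

Definition hat (n m : nat) (nu : intpartition n m) :
    composition m (size (undup nu)) :=
  Composition (mult_tuple_gt0 nu) (mult_tuple_sum nu).

(* The (i, j) block of C, partitioned according to mu. *)
Definition blk (K : fieldType) (m l : nat) (mu : composition m l)
    (C : 'M[K]_m) (i j : 'I_l) : 'M[K]_(tnth mu i, tnth mu j) :=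
  submxblock (castmx (esym (cparts_sum mu), esym (cparts_sum mu)) C) i j.

Definition block_lower (K : fieldType) (m l : nat) (mu : composition m l)
    (C : 'M[K]_m) : Prop :=
  forall i j : 'I_l, (i < j)%N -> blk mu C i j = 0.

Definition block_upper (K : fieldType) (m l : nat) (mu : composition m l)
    (C : 'M[K]_m) : Prop :=
  forall i j : 'I_l, (j < i)%N -> blk mu C i j = 0.

Definition mutual (K : fieldType) (m l : nat) (mu : composition m l)
    (C C' : 'M[K]_m) : Prop :=
  [/\ C \in unitmx, C' \in unitmx, block_lower mu C, block_upper mu C'
    & forall i : 'I_l, blk mu C i i = blk mu C' i i].

Definition mu_similar (K : fieldType) (m l : nat) (mu : composition m l)
    (X Y : 'M[K]_m) : Prop :=
  exists C C' : 'M[K]_m, mutual mu C C' /\ C *m X = Y *m C'.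

(* Main.v *)
(* Keeping the last row (index set L) and the first column (index set F) of each
   Jordan block turns X into X_{P,Q} = X_{L,F}. If E commutes with J, its rows
   in L vanish outside the columns in L, and its columns in F vanish outside the
   rows in F, so (E M)_{L,F} = E_{L,L} M_{L,F} and (M E)_{L,F} = M_{L,F} E_{F,F}.
   With E = B^-1 this gives E_{L,L} (B A B^-1)_{L,F} = A_{L,F} E_{F,F}. The
   Toeplitz structure of the blocks of E makes (E_{L,L}, E_{F,F}) a mutual pair,
   and every mutual pair arises in this way. *)
From HB Require Import structures.
Require Import Defs.
From mathcomp Require Import all_boot all_order all_algebra zify.

Set Implicit Arguments.
Unset Strict Implicit.
Unset Printing Implicit Defensive.

Import GRing.Theory.
Local Open Scope ring_scope.

(** * The kept rows and columns as last and first indices *)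

(** [enum A] and the list of values of [f] are both strictly increasing with the same elements,
    hence equal. *)
Lemma enum_val_imset_homo (m n : nat) (f : 'I_m -> 'I_n) (A : {set 'I_n})
    (fA : A = [set f i | i in 'I_m]) (cA : #|A| = m) (i : 'I_m) :
  {homo f : i j / (i < j)%N} -> enum_val (cast_ord (esym cA) i) = f i.
Proof.
move=> f_lt.
have sorted_enum p (B : {pred 'I_p}) : sorted ltn (map val (enum B)).
  rewrite sorted_map /enum_mem; apply: sorted_filter => [x y z|].
    exact: ltn_trans.
  by rewrite -enumT -sorted_map val_enum_ord iota_ltn_sorted.
have eq_enum : enum A = map f (enum 'I_m).
  apply: (inj_map val_inj); apply: (irr_sorted_eq ltn_trans ltnn) => //.
    have := sorted_enum _ 'I_m; rewrite !sorted_map.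
    by apply: sub_sorted => j k; apply: f_lt.
  move=> x; apply: eq_mem_map => k; rewrite mem_enum fA.
  by apply/imsetP/mapP => -[j _ ->]; exists j => //; rewrite mem_enum.
rewrite (enum_val_nth (f i)) /= eq_enum (nth_map i) ?nth_ord_enum //.
by rewrite size_enum_ord.
Qed.

Lemma ltn_Rank (m : nat) (p : 'I_m -> nat) (i j : 'I_m) (a : 'I_(p i))
    (b : 'I_(p j)) :
  (i < j)%N -> (tagnat.Rank i a < tagnat.Rank j b)%N.
Proof.
move=> ltij; rewrite ltnNge; apply/negP => le_ji.
have := tagnat.le_sig1 (p_ := p) le_ji.
by rewrite !tagnat.Rank1K leEord leqNgt ltij.
Qed.

Lemma submxPQE (K : fieldType) (n m : nat) (nu : intpartition n m)
    (X : 'M[K]_n) :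
  submxPQ nu X = mxsub (@last_idx n m nu) (@first_idx n m nu) X.
Proof.
apply/matrixP => i j; rewrite /submxPQ castmxE !mxE.
congr (X _ _); apply: enum_val_imset_homo.
- exact: nzrowsC.
- by move=> k l; apply: ltn_Rank.
- exact: nzcolsC.
- by move=> k l; apply: ltn_Rank.
Qed.

(** * Block coordinates of a composition *)

Section Blocks.
Variables (n m : nat) (c : composition n m).

Definition part_of (k : 'I_n) : 'I_m :=
  tagnat.sig1 (cast_ord (esym (cparts_sum c)) k).

Definition offset_of (k : 'I_n) : 'I_(tnth c (part_of k)) :=
  tagnat.sig2 (cast_ord (esym (cparts_sum c)) k).

Definition idx (i : 'I_m) (a : 'I_(tnth c i)) : 'I_n :=
  cast_ord (cparts_sum c) (tagnat.Rank i a).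

Lemma idxK (k : 'I_n) : idx (offset_of k) = k.
Proof. by rewrite /idx tagnat.sig2K cast_ordKV. Qed.

Lemma part_of_idx (i : 'I_m) (a : 'I_(tnth c i)) : part_of (idx a) = i.
Proof. by rewrite /part_of cast_ordK tagnat.Rank1K. Qed.

Lemma eq_idx (i j : 'I_m) (a : 'I_(tnth c i)) (b : 'I_(tnth c j)) :
  (idx a == idx b) = (i == j) && (a == b :> nat).
Proof. by rewrite -val_eqE /= tagnat.eq_Rank. Qed.

Lemma offset_of_idx (i : 'I_m) (a : 'I_(tnth c i)) :
  offset_of (idx a) = a :> nat.
Proof.
apply/eqP; have := eq_idx (offset_of (idx a)) a.
by rewrite idxK eqxx => /esym/andP[].
Qed.

Lemma blkE (K : fieldType) (C : 'M[K]_n) (i j : 'I_m) (a : 'I_(tnth c i))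
    (b : 'I_(tnth c j)) : blk c C i j a b = C (idx a) (idx b).
Proof. by rewrite /blk mxE castmxE !esymK. Qed.

(** Passing to entries removes the dependently typed blocks. *)
Lemma mutualP (K : fieldType) (C C' : 'M[K]_n) :
  mutual c C C' <->
  [/\ C \in unitmx, C' \in unitmx &
   forall k l, [/\ (part_of k < part_of l)%N -> C k l = 0,
     (part_of l < part_of k)%N -> C' k l = 0 &
     part_of k = part_of l -> C k l = C' k l]].
Proof.
split=> [[uC uC' loC upC' eqCC']|[uC uC' CC']]; split=> //.
- move=> k l; split=> [lt_kl|lt_lk|eq_kl].
  + by rewrite -(idxK k) -(idxK l) -blkE loC // mxE.
  + by rewrite -(idxK k) -(idxK l) -blkE upC' // mxE.
  + rewrite -(idxK k) -(idxK l); move: (offset_of k) (offset_of l).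
    by case: _ / eq_kl => a b; rewrite -!blkE eqCC'.
- move=> i j ltij; apply/matrixP => a b; rewrite blkE mxE.
  by have [-> //] := CC' (idx a) (idx b); rewrite !part_of_idx.
- move=> i j ltji; apply/matrixP => a b; rewrite blkE mxE.
  by have [_ -> //] := CC' (idx a) (idx b); rewrite !part_of_idx.
- move=> i; apply/matrixP => a b; rewrite !blkE.
  by have [_ _ -> //] := CC' (idx a) (idx b); rewrite !part_of_idx.
Qed.

End Blocks.

(** * Blocks of [hat nu] as runs of equal parts *)

Lemma sorted_flatten_nseq (f : nat -> nat) (s : seq nat) :
  sorted geq s -> sorted geq (flatten [seq nseq (f x) x | x <- s]).
Proof.
have geq_trans : transitive geq by move=> x y z /[swap]; exact: leq_trans.
rewrite !sorted_pairwise //; elim: s => //= x s IHs /andP[x_ge /IHs srt_s].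
rewrite pairwise_cat srt_s andbT; apply/andP; split.
  apply/allrelP => y z /nseqP[-> _] /flatten_mapP[w ws /nseqP[-> _]].
  exact: (allP x_ge).
by elim: (f x) => //= k ->; rewrite andbT; apply/allP => y /nseqP[-> _] /=.
Qed.

Lemma flatten_count_undup (s : seq nat) :
  sorted geq s -> flatten [seq nseq (count_mem x s) x | x <- undup s] = s.
Proof.
have geq_trans : transitive geq by move=> x y z /[swap]; exact: leq_trans.
move=> srt_s; apply: (sorted_eq geq_trans) (perm_count_undup s) => //.
  by move=> x y; rewrite andbC; apply: anti_leq.
by apply: sorted_flatten_nseq; apply: undup_sorted.
Qed.

(** Since [nu] is sorted, it is the concatenation of its constant runs, and block coordinates for
    [hat nu] are positions in that concatenation. *)
Lemma nth_part_of_hat (n m : nat) (nu : intpartition n m) (k : 'I_m) :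
  nth 0%N (undup nu) (part_of (hat nu) k) = tnth nu k.
Proof.
set mu := mult_tuple nu; set p := part_of _ k.
have off_lt : (offset_of (hat nu) k < nth 0%N mu p)%N.
  by rewrite -tnth_nth ltn_ord.
pose ss := [seq nseq (count_mem x nu) x | x <- undup nu].
have shape_ss : shape ss = mu.
  by rewrite /shape -map_comp; apply: eq_map => x /=; rewrite size_nseq.
have k_eq : k = flatten_index (shape ss) p (offset_of (hat nu) k) :> nat.
  have -> : k = tagnat.Rank p (offset_of (hat nu) k) :> nat.
    by rewrite -[in LHS](idxK (hat nu) k).
  rewrite tagnat.RankEsum.
  rewrite /flatten_index shape_ss; congr (_ + _)%N.
  rewrite sumnE (big_nth 0%N) size_take size_tuple ltn_ord big_mkord.
  rewrite (big_ord_widen _ (nth 0%N (take p mu)) (ltnW (ltn_ord p))).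
  by apply: eq_bigr => i ltip; rewrite nth_take // -tnth_nth.
rewrite (tnth_nth 0%N) -[in RHS](flatten_count_undup (ip_sorted nu)) -/ss.
rewrite nth_flatten k_eq flatten_indexKl ?flatten_indexKr ?shape_ss //.
rewrite (nth_map 0%N) ?ltn_ord // nth_nseq.
(* The default value of [nth] cannot occur: the offset is below the length of the run. *)
case: ifP => // /negP[]; move: off_lt.
by rewrite (nth_map 0%N) ?ltn_ord.
Qed.

Lemma ltn_part_of_hat (n m : nat) (nu : intpartition n m) (k l : 'I_m) :
  (part_of (hat nu) k < part_of (hat nu) l)%N = (tnth nu l < tnth nu k)%N.
Proof.
have gtn_trans : transitive gtn by move=> x y z /[swap]; exact: ltn_trans.
have srt : sorted gtn (undup nu).
  rewrite gtn_sorted_uniq_geq undup_uniq undup_sorted ?ip_sorted //.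
  by move=> x y z /[swap]; exact: leq_trans.
have nth_gt i j : (i < j)%N -> (j < size (undup nu))%N ->
    (nth 0 (undup nu) j < nth 0 (undup nu) i)%N.
  move=> ltij ltj; apply: (sorted_ltn_nth gtn_trans 0%N srt) => //.
  by rewrite inE (ltn_trans ltij).
rewrite -!nth_part_of_hat; case: ltngtP => [lt_kl|lt_lk|->].
- by rewrite nth_gt.
- by apply/esym/negbTE; rewrite -leqNgt ltnW ?nth_gt.
- by rewrite ltnn.
Qed.

(** The distinct parts decrease, so block order becomes reversed order of parts, and triangularity
    becomes a comparison of Jordan block sizes. *)
Lemma mutual_hatP (K : fieldType) (n m : nat) (nu : intpartition n m)
    (D D' : 'M[K]_m) :
  mutual (hat nu) D D' <->
  [/\ D \in unitmx, D' \in unitmx &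
   forall i j, [/\ (tnth nu j < tnth nu i)%N -> D i j = 0,
     (tnth nu i < tnth nu j)%N -> D' i j = 0 &
     tnth nu i = tnth nu j -> D i j = D' i j]].
Proof.
have eq_part i j :
    part_of (hat nu) i = part_of (hat nu) j <-> tnth nu i = tnth nu j.
  split=> [eq_ij|eq_ij]; first by rewrite -!nth_part_of_hat eq_ij.
  apply: val_inj.
  have := ltn_part_of_hat nu i j; have := ltn_part_of_hat nu j i.
  by rewrite eq_ij ltnn; case: ltngtP.
split=> [/mutualP[uD uD' DD']|[uD uD' DD']]; [|apply/mutualP]; split=> // i j;
  have := DD' i j; rewrite (ltn_part_of_hat nu i j) (ltn_part_of_hat nu j i);
  by case=> D0 D'0 eqDD'; split=> // /eq_part.
Qed.

Lemma mulmx_codom (K : fieldType) (p q m n : nat) (f : 'I_m -> 'I_n)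
    (M : 'M[K]_(p, n)) (N : 'M[K]_(n, q)) :
  injective f -> (forall k i j, k \notin codom f -> M i k * N k j = 0) ->
  M *m N = colsub f M *m rowsub f N.
Proof.
move=> f_inj MN0; apply/matrixP => i j; rewrite !mxE.
rewrite (bigID (mem [set f x | x in 'I_m])) /= [X in _ + X]big1 ?addr0.
  rewrite big_imset /=; last by move=> ? ? _ _; apply: f_inj.
  by apply: eq_bigr => k _; rewrite !mxE.
move=> k kNf; apply: MN0; apply: contra kNf => /codomP[x ->].
exact: imset_f.
Qed.

(** * Toeplitz structure of the centralizer of [J] *)

Section Centralizer.
Variables (K : fieldType) (n m : nat) (nu : intpartition n m).
Local Notation J := (jordan_mx K nu).
Local Notation lastI := (@last_idx n m nu).
Local Notation firstI := (@first_idx n m nu).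

Lemma jordan_mxE_idx (i j : 'I_m) (a : 'I_(tnth nu i)) (b : 'I_(tnth nu j)) :
  J (idx a) (idx b) = ((i == j) && (a.+1 == b :> nat))%:R.
Proof. exact: jordan_mxE. Qed.

(** Right multiplication by [J] moves columns one step right inside each Jordan block, so a zero
    column enters first. *)
Lemma mulmx_jordan0 (p : nat) (M : 'M[K]_(p, n)) k (j : 'I_m)
    (b : 'I_(tnth nu j)) : b = 0%N :> nat -> (M *m J) k (idx b) = 0.
Proof.
move=> b0; rewrite mxE big1 // => l _.
by rewrite -(idxK nu l) jordan_mxE_idx b0 andbF mulr0.
Qed.

Lemma mulmx_jordanS (p : nat) (M : 'M[K]_(p, n)) k (j : 'I_m)
    (a b : 'I_(tnth nu j)) :
  b = a.+1 :> nat -> (M *m J) k (idx b) = M k (idx a).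
Proof.
move=> bS; rewrite mxE (bigD1 (idx a)) //= jordan_mxE_idx bS !eqxx mulr1.
rewrite big1 ?addr0 // => l; rewrite -(idxK nu l) eq_idx jordan_mxE_idx bS eqSS.
by move=> /negbTE->; rewrite mulr0.
Qed.

(** Dually, left multiplication by [J] moves rows one step up, so a zero row enters last. *)
Lemma jordan_mulmx_last (p : nat) (M : 'M[K]_(n, p)) k (i : 'I_m)
    (a : 'I_(tnth nu i)) : a.+1 = tnth nu i -> (J *m M) (idx a) k = 0.
Proof.
move=> a_last; rewrite mxE big1 // => l _; rewrite -(idxK nu l).
rewrite jordan_mxE_idx a_last; case: eqP => [eq_i|_]; last by rewrite mul0r.
by rewrite gtn_eqF ?mul0r // eq_i ltn_ord.
Qed.

Lemma jordan_mulmxS (p : nat) (M : 'M[K]_(n, p)) k (i : 'I_m)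
    (a b : 'I_(tnth nu i)) :
  b = a.+1 :> nat -> (J *m M) (idx a) k = M (idx b) k.
Proof.
move=> bS; rewrite mxE (bigD1 (idx b)) //= jordan_mxE_idx -bS !eqxx mul1r.
rewrite big1 ?addr0 // => l; rewrite -(idxK nu l) eq_idx jordan_mxE_idx -bS.
by rewrite eq_sym [X in _ && X]eq_sym => /negbTE->; rewrite mul0r.
Qed.

Lemma notin_codom_last (k : 'I_n) :
  k \notin codom lastI -> ((offset_of nu k).+1 < tnth nu (part_of nu k))%N.
Proof.
rewrite ltn_neqAle ltn_ord andbT; apply: contra => /eqP k_last.
apply/codomP; exists (part_of nu k); rewrite -[LHS](idxK nu).
by apply/eqP; rewrite eq_idx eqxx /= -[X in _ == X.-1]k_last.
Qed.

Lemma notin_codom_first (k : 'I_n) :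
  k \notin codom firstI -> (0 < offset_of nu k)%N.
Proof.
rewrite lt0n; apply: contra => k_first.
apply/codomP; exists (part_of nu k); rewrite -[LHS](idxK nu).
by apply/eqP; rewrite eq_idx eqxx.
Qed.

Section Commuting.
Variables (E : 'M[K]_n) (EJ : E *m J = J *m E).

(** Both values are the entry of [E *m J = J *m E] at row [idx a] and column [idx b1]. *)
Lemma centralizer_shift1 (i j : 'I_m) (a a1 : 'I_(tnth nu i))
    (b b1 : 'I_(tnth nu j)) :
  a1 = a.+1 :> nat -> b1 = b.+1 :> nat ->
  E (idx a1) (idx b1) = E (idx a) (idx b).
Proof.
by move=> a1E b1E; rewrite -(mulmx_jordanS _ _ b1E) EJ (jordan_mulmxS _ _ a1E).
Qed.

Lemma centralizer_shift (t : nat) (i j : 'I_m) (a a1 : 'I_(tnth nu i))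
    (b b1 : 'I_(tnth nu j)) :
  a1 = (a + t)%N :> nat -> b1 = (b + t)%N :> nat ->
  E (idx a1) (idx b1) = E (idx a) (idx b).
Proof.
elim: t => [|t IHt] in a1 b1 *.
  by rewrite !addn0 => /val_inj-> /val_inj->.
rewrite !addnS => a1E b1E.
have lta : (a + t < tnth nu i)%N by rewrite ltnW // -a1E.
have ltb : (b + t < tnth nu j)%N by rewrite ltnW // -b1E.
by rewrite (@centralizer_shift1 _ _ (Ordinal lta) _ (Ordinal ltb)) ?IHt.
Qed.

Lemma centralizer_first (i j : 'I_m) (a : 'I_(tnth nu i)) :
  (0 < a)%N -> E (idx a) (firstI j) = 0.
Proof.
move=> a_gt0; have lta : (a.-1 < tnth nu i)%N.
  by rewrite (leq_ltn_trans (leq_pred a)).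
rewrite -(@jordan_mulmxS _ _ _ _ (Ordinal lta)) /= ?prednK // -EJ.
exact: mulmx_jordan0.
Qed.

Lemma centralizer_last (i j : 'I_m) (b : 'I_(tnth nu j)) :
  (b.+1 < tnth nu j)%N -> E (lastI i) (idx b) = 0.
Proof.
move=> ltb; rewrite -(@mulmx_jordanS _ _ _ _ _ (Ordinal ltb)) // EJ.
by apply: jordan_mulmx_last; rewrite /= prednK ?cpart_gt0.
Qed.

Lemma mxsub_last_mulmx (p q : nat) (g : 'I_q -> 'I_p) (M : 'M[K]_(n, p)) :
  mxsub lastI g (E *m M) = mxsub lastI lastI E *m mxsub lastI g M.
Proof.
rewrite mxsub_mul (mulmx_codom (@last_idx_inj _ _ nu)) -?mxsubcr -?mxsubrc //.
move=> k i j /notin_codom_last k_last.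
by rewrite mxE -(idxK nu k) centralizer_last ?mul0r.
Qed.

Lemma mxsub_mulmx_first (p q : nat) (f : 'I_p -> 'I_q) (M : 'M[K]_(q, n)) :
  mxsub f firstI (M *m E) = mxsub f firstI M *m mxsub firstI firstI E.
Proof.
rewrite mxsub_mul (mulmx_codom (@first_idx_inj _ _ nu)) -?mxsubcr -?mxsubrc //.
move=> k i j /notin_codom_first k_first.
by rewrite [X in _ * X]mxE -(idxK nu k) centralizer_first ?mulr0.
Qed.

End Commuting.

Lemma mxsub1 (f : 'I_m -> 'I_n) :
  injective f -> mxsub f f 1%:M = 1%:M :> 'M[K]_m.
Proof. by move=> f_inj; apply/matrixP => i j; rewrite !mxE inj_eq. Qed.

Lemma in_centralizer_inv (E : 'M[K]_n) :
  in_centralizer nu E -> in_centralizer nu (invmx E).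
Proof.
case=> uE EJ; split; first by rewrite unitmx_inv.
by rewrite -[RHS](mulKmx uE) (mulmxA E) EJ -(mulmxA J) mulmxV // mulmx1.
Qed.

Lemma mutual_centralizer (E : 'M[K]_n) :
  in_centralizer nu E ->
  mutual (hat nu) (mxsub lastI lastI E) (mxsub firstI firstI E).
Proof.
move=> cE; have [uE EJ] := cE; have [_ FJ] := in_centralizer_inv cE.
apply/mutual_hatP; split.
- have /mulmx1_unit[] // :
    mxsub lastI lastI E *m mxsub lastI lastI (invmx E) = 1%:M.
  by rewrite -mxsub_last_mulmx // mulmxV // mxsub1 //; apply: last_idx_inj.
- have /mulmx1_unit[] // :
    mxsub firstI firstI E *m mxsub firstI firstI (invmx E) = 1%:M.
  by rewrite -mxsub_mulmx_first // mulmxV // mxsub1 //; apply: first_idx_inj.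
move=> i j; have i_gt0 := cpart_gt0 nu i; have j_gt0 := cpart_gt0 nu j.
rewrite !mxE; split=> [ltji|ltij|eqij].
(* The diagonal through the bottom right corner of this tall block meets the first column below its
   top, where [E] vanishes. *)
- have lt_off : (tnth nu i - tnth nu j < tnth nu i)%N by lia.
  rewrite -(@centralizer_first _ EJ i j (Ordinal lt_off)) ?subn_gt0 //.
  by apply: (@centralizer_shift _ EJ (tnth nu j).-1) => /=; lia.
(* The diagonal through the top left corner of this wide block meets the last row before its end,
   where [E] vanishes. *)
- have lt_off : ((tnth nu i).-1 < tnth nu j)%N by lia.
  rewrite -(@centralizer_last _ EJ i j (Ordinal lt_off)) /=; last by lia.
  by apply/esym; apply: (@centralizer_shift _ EJ (tnth nu i).-1) => /=; lia.
(* In a square block both corners lie on the main diagonal. *)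
- by apply: (@centralizer_shift _ EJ (tnth nu i).-1) => /=; lia.
Qed.

(** * Centralizer elements with a prescribed mutual pair *)

(* The left kernel of E is J-stable and J is nilpotent, so if it is nonzero it
   meets the left kernel of J, the span of the last unit row of each Jordan
   block, on which E acts as its last-rows-last-columns submatrix. *)
Lemma unitmx_centralizer (E : 'M[K]_n) :
  E *m J = J *m E -> mxsub lastI lastI E \in unitmx -> E \in unitmx.
Proof.
move=> EJ uD.
have ker0 (u : 'rV[K]_n) : u *m J = 0 -> u *m E = 0 -> u = 0.
  move=> uJ0 uE0.
  have u0 i (a : 'I_(tnth nu i)) : (a.+1 < tnth nu i)%N -> u 0 (idx a) = 0.
    by move=> lta; rewrite -(@mulmx_jordanS _ _ _ _ _ (Ordinal lta)) ?uJ0 ?mxE.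
  have uD0 : colsub lastI u *m mxsub lastI lastI E = 0.
    rewrite (mxsubrc lastI lastI) -(mulmx_codom (@last_idx_inj _ _ nu)).
      by rewrite mulmx_colsub uE0 linear0.
    move=> k i j /notin_codom_last k_last.
    by rewrite ord1 -(idxK nu k) u0 ?mul0r.
  have uL0 : colsub lastI u = 0 by rewrite -(mulmxK uD (colsub _ u)) uD0 mul0mx.
  apply/rowP => k; rewrite mxE.
  have [/codomP[i ->]|/notin_codom_last k_last] := boolP (k \in codom lastI).
    by move/rowP: uL0 => /(_ i); rewrite !mxE.
  by rewrite -(idxK nu k) u0.
(* Here [u] is supported on the last [t] positions of each Jordan block; passing to [u *m J] lowers
   [t] by one, so induction gives [u *m J = 0]. *)
have ker_step t (u : 'rV[K]_n) : u *m E = 0 ->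
    (forall i (a : 'I_(tnth nu i)), (a + t < tnth nu i)%N -> u 0 (idx a) = 0) ->
  u = 0.
  elim: t u => [|t IHt] u uE0 u0.
    by apply/rowP => k; rewrite -(idxK nu k) u0 ?addn0 ?mxE.
  apply: ker0 => //; apply: IHt => [|i a lta].
    by rewrite -mulmxA -EJ mulmxA uE0 mul0mx.
  case: a lta => [[|a] lt_a] /= lta; first exact: mulmx_jordan0.
  rewrite (@mulmx_jordanS _ _ _ _ (Ordinal (ltnW lt_a))) // u0 //=; lia.
rewrite -row_free_unit -kermx_eq0; apply/eqP/row_matrixP => k; rewrite row0.
(* With this [t] the support condition is vacuous. *)
apply: (ker_step (\max_i tnth nu i)%N) => [|i a].
  by rewrite -row_mul mulmx_ker row0.
by have := leq_bigmax (F := tnth nu) i; lia.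
Qed.

(* In the (i, j) block, a Toeplitz matrix: for nu_i <= nu_j the diagonal ending
   in the bottom right corner carries D i j, and otherwise the one starting in
   the top left corner carries D' i j. *)
Definition centralizer_of (D D' : 'M[K]_m) : 'M[K]_n :=
  \matrix_(k, l)
    let i := part_of nu k in let j := part_of nu l in
    let a := offset_of nu k in let b := offset_of nu l in
    if (tnth nu i <= tnth nu j)%N
    then D i j *+ (b == a + (tnth nu j - tnth nu i) :> nat)%N
    else D' i j *+ (a == b :> nat).

Lemma centralizer_ofE (D D' : 'M[K]_m) (i j : 'I_m) (a : 'I_(tnth nu i))
    (b : 'I_(tnth nu j)) :
  centralizer_of D D' (idx a) (idx b) =
    if (tnth nu i <= tnth nu j)%N
    then D i j *+ (b == a + (tnth nu j - tnth nu i) :> nat)%N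
    else D' i j *+ (a == b :> nat).
Proof. by rewrite mxE /= !offset_of_idx !part_of_idx. Qed.

(** Both products shift along diagonals. At the borders, the nonzero diagonal of a block meets the
    first column at most at its top and the last row at most at its end. *)
Lemma centralizer_of_comm (D D' : 'M[K]_m) :
  centralizer_of D D' *m J = J *m centralizer_of D D'.
Proof.
apply/matrixP => k l; rewrite -(idxK nu k) -(idxK nu l).
move: (part_of nu k) (part_of nu l) (offset_of nu k) (offset_of nu l).
move=> i j a b.
have lt_a := ltn_ord a; have lt_b := ltn_ord b.
have [b0|b_gt0] := posnP b.
  rewrite mulmx_jordan0 //; have [lt_aS|le_aS] := ltnP a.+1 (tnth nu i).
    rewrite (@jordan_mulmxS _ _ _ _ _ (Ordinal lt_aS)) // centralizer_ofE /= b0.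
    by case: ifP; rewrite mulr0n.
  by rewrite jordan_mulmx_last //; lia.
have lt_bP : (b.-1 < tnth nu j)%N by lia.
rewrite (@mulmx_jordanS _ _ _ _ (Ordinal lt_bP)) ?prednK // centralizer_ofE /=.
have [lt_aS|le_aS] := ltnP a.+1 (tnth nu i).
  rewrite (@jordan_mulmxS _ _ _ _ _ (Ordinal lt_aS)) // centralizer_ofE /=.
  by case: leqP => ij; congr (_ *+ nat_of_bool _); lia.
rewrite jordan_mulmx_last; last by lia.
by case: leqP => ij; case: eqP => //; lia.
Qed.

Lemma centralizer_of_last (D D' : 'M[K]_m) :
  mutual (hat nu) D D' -> mxsub lastI lastI (centralizer_of D D') = D.
Proof.
case/mutual_hatP => _ _ DD'; apply/matrixP => i j.
have i_gt0 := cpart_gt0 nu i; have j_gt0 := cpart_gt0 nu j.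
have [D0 _ _] := DD' i j; rewrite mxE centralizer_ofE /=.
(* For [nu_i > nu_j] the bottom right corner is off the nonzero diagonal, matching [D i j = 0]. *)
case: leqP => [leij|/[dup] ltji /D0->].
  by case: eqP => //; lia.
by case: eqP => //; lia.
Qed.

Lemma centralizer_of_first (D D' : 'M[K]_m) :
  mutual (hat nu) D D' -> mxsub firstI firstI (centralizer_of D D') = D'.
Proof.
case/mutual_hatP => _ _ DD'; apply/matrixP => i j.
have [_ D'0 eqDD'] := DD' i j; rewrite mxE centralizer_ofE /=.
(* Square blocks are filled from [D], so mutuality is needed to read off [D']. *)
case: (ltngtP (tnth nu i) (tnth nu j)) => [ltij|//|eqij].
  by rewrite D'0 // eq_sym add0n subn_eq0 leqNgt ltij.
by rewrite eqDD' // eqij subnn.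
Qed.

Lemma in_centralizer_of (D D' : 'M[K]_m) :
  mutual (hat nu) D D' -> in_centralizer nu (centralizer_of D D').
Proof.
move=> mDD'; split; last exact: centralizer_of_comm.
apply: unitmx_centralizer; first exact: centralizer_of_comm.
by rewrite centralizer_of_last //; case: mDD'.
Qed.

Lemma submxPQ_conj (B A : 'M[K]_n) :
  in_centralizer nu B ->
  mxsub lastI lastI (invmx B) *m submxPQ nu (B *m A *m invmx B) =
  submxPQ nu A *m mxsub firstI firstI (invmx B).
Proof.
move=> cB; have [uB _] := cB; have [_ FJ] := in_centralizer_inv cB.
rewrite !submxPQE -mxsub_last_mulmx // -mxsub_mulmx_first //.
by rewrite !mulmxA mulVmx ?mul1mx.
Qed.

End Centralizer.

Theorem theorem2p4 (K : closedFieldType) (charK0 : [pchar K] =i pred0)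
    (n m : nat) (nu : intpartition n m) (A : 'M[K]_n) (X : 'M[K]_m) :
  (exists B : 'M[K]_n,
     in_centralizer nu B /\ X = submxPQ nu (B *m A *m invmx B)) <->
  mu_similar (hat nu) X (submxPQ nu A).
Proof.
split=> [[B [cB ->]]|[D [D' [mDD' DX]]]].
  exists (mxsub (@last_idx n m nu) (@last_idx n m nu) (invmx B)).
  exists (mxsub (@first_idx n m nu) (@first_idx n m nu) (invmx B)).
  split; last exact: submxPQ_conj.
  by apply: mutual_centralizer; apply: in_centralizer_inv.
(* The conjugation identity involves the inverse of [B], so that inverse is taken to be the Toeplitz
   matrix of [D] and [D']; cancelling [D] then gives [X]. *)
have cB := in_centralizer_inv (in_centralizer_of mDD').
exists (invmx (centralizer_of nu D D')); split=> //.
have := submxPQ_conj A cB; rewrite invmxK.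
rewrite centralizer_of_last // centralizer_of_first // -DX.
have [uD _ _ _ _] := mDD'.
by move/(can_inj (mulKmx uD)) => <-.
Qed.
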